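(* Let $p(t)=\sum_{k=0}^m c_k e^{\lambda_k t}$, $c_k,\lambda_k\in\mathbb{C}$, be an exponential polynomial, let $B\subset\mathbb{R}$ be a bounded interval, and let $D=D(p,B)$ be the diagram of $p$ on $B$. For any bounded measurable set $\Omega\subset\mathbb{R}$ we have $\omega_D(\Omega)\ge\mu_1(\Omega)$, with equality if $\Omega=V_\rho$ is a sublevel set of $p$.
   Context: $\mu_1$ is Lebesgue measure on $\mathbb{R}$. An exponential polynomial $p(t)=\sum_{k=0}^m c_k e^{\lambda_k t}$ with $c_k,\lambda_k\in\mathbb{C}$ is said to have degree $m$ and maximal frequency $\lambda=\max_{k=0,\dots,m}|\operatorname{Im}\lambda_k|$. For an interval $B$ of length $l=\mu_1(B)$, the diagram is $D=D(p,B)=(m,\lambda,l)$. The sublevel sets of $p$ are $V_\rho=\{t\in B:\ |p(t)|\le\rho\}$. Let $d=d(m,\lambda,l)$ be the maximal number of (isolated) solutions $t$ of an equation $|p(t)|=\rho$ on an interval of length $l$, over all $\rho\in\mathbb{R}$ and all complex exponential polynomials $p$ of degree $m$ and maximal frequency $\lambda$. The frequency bound is $M_D=\lfloor d/2\rfloor+1$. For bounded $\Omega\subset\mathbb{R}$ and $\varepsilon>0$, $M(\varepsilon,\Omega)$ is the minimal number of intervals of length $\varepsilon$ covering $\Omega$. The metric span of $\Omega$ is $$\omega_D(\Omega)=\sup_{\varepsilon>0}\varepsilon\,[M(\varepsilon,\Omega)-M_D].$$ *)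

(* Defs.v *)
From HB Require Import structures.
From mathcomp Require Import all_boot all_order all_algebra.
From mathcomp Require Import complex.
From mathcomp Require Import all_classical all_reals all_analysis.

Set Implicit Arguments.
Unset Strict Implicit.
Unset Printing Implicit Defensive.

Import Order.TTheory GRing.Theory Num.Theory.
Import numFieldNormedType.Exports.

Local Open Scope classical_set_scope.
Local Open Scope ring_scope.
Local Open Scope complex_scope.

Definition cexp (R : realType) (z : R[i]) : R[i] :=
  (expR (complex.Re z) * cos (complex.Im z)) +i*
  (expR (complex.Re z) * sin (complex.Im z)).

(* An exponential polynomial is kept as a formal sum: the degree m and the
   maximal frequency depend on the chosen coefficients and exponents, which
   may vanish or coincide. *)
Record exp_poly (R : realType) (m : nat) := ExpPoly {
  coef : 'I_m.+1 -> R[i];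
  expo : 'I_m.+1 -> R[i] }.

Definition ep_eval (R : realType) (m : nat) (p : exp_poly R m) (t : R) : R[i] :=
  \sum_(k < m.+1) coef p k * cexp (expo p k * t%:C).

(* The default 0 of the iterated maximum is harmless: the values are
   nonnegative and there is at least one index. *)
Definition max_freq (R : realType) (m : nat) (p : exp_poly R m) : R :=
  \big[Num.max/0]_(k < m.+1) `|complex.Im (expo p k)|.

(* Lebesgue measure on the full Lebesgue (Caratheodory) sigma-algebra, not only
   on Borel sets. *)
Definition mu1 (R : realType) (A : set R) : \bar R :=
  @completed_lebesgue_measure R A.

Definition lebesgue_measurable (R : realType) (A : set R) : Prop :=
  (@wlength R idfun)^*%mu.-cara.-measurable A.

(* Intervals may be open, closed or half-open, and of length 0. *)
Definition interval_of_length (R : realType) (l : R) (I : set R) : Prop :=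
  is_interval I /\ mu1 I = l%:E.

Definition sublevel (R : realType) (m : nat) (p : exp_poly R m) (B : set R)
    (rho : R) : set R :=
  [set t | B t /\ `|ep_eval p t| <= rho%:C].

Definition level_solutions (R : realType) (m : nat) (p : exp_poly R m)
    (I : set R) (rho : R) : set R :=
  [set t | I t /\ `|ep_eval p t| = rho%:C].

Record diagram (R : realType) := Diagram {
  dg_degree : nat;
  dg_freq : R;
  dg_length : R }.

Definition diagram_of (R : realType) (m : nat) (p : exp_poly R m) (B : set R) :
  diagram R := Diagram m (max_freq p) (fine (mu1 B)).

Definition is_max_solutions (R : realType) (D : diagram R) (d : nat) : Prop :=
  let admissible (p : exp_poly R (dg_degree D)) (I : set R) :=
    max_freq p = dg_freq D /\ interval_of_length (dg_length D) I in
  (exists p I rho, admissible p I /\ (isolated (level_solutions p I rho) #= `I_d)%card)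
  /\ (forall p I rho, admissible p I ->
        (isolated (level_solutions p I rho) #<= `I_d)%card).

(* The number d(m, lambda, l). *)
Definition max_solutions (R : realType) (D : diagram R) : nat :=
  xget 0%N [set d | is_max_solutions D d].

Definition freq_bound (R : realType) (D : diagram R) : nat :=
  ((max_solutions D)./2).+1.

Definition covered_by (R : realType) (eps : R) (Omega : set R) (n : nat) : Prop :=
  exists J : 'I_n -> set R,
    (forall i, interval_of_length eps (J i)) /\
    Omega `<=` \bigcup_(i in [set: 'I_n]) J i.

(* The number M(eps, Omega). *)
Definition covering_number (R : realType) (eps : R) (Omega : set R) : nat :=
  xget 0%N [set n | covered_by eps Omega n /\
                    forall k, covered_by eps Omega k -> (n <= k)%N].

(* The subtraction takes place in R, so negative values are kept. *)
Definition metric_span (R : realType) (D : diagram R) (Omega : set R) : \bar R :=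
  ereal_sup [set (eps * ((covering_number eps Omega)%:R - (freq_bound D)%:R))%:E
            | eps in [set eps : R | 0 < eps]].

(* Main.v *)
(** Lower bound: a covering of [Omega] by [M] intervals of length [eps] gives
    [mu1 Omega <= eps * M], and [eps * M_D] tends to [0] with [eps].

    Upper bound for [V = V_rho]: if [n] intervals of length [eps] do not cover
    [V], a greedy choice yields [t_0, ..., t_n] in the closure of [V] with
    [t_i + eps <= t_(i+1)].  When [V] contains ]t_i, t_(i+1)[, this gap
    contributes at least [eps] to [mu1 V].  Otherwise [|p|] exceeds [rho] inside
    the gap, and for [rho' > rho] close enough to [rho] the equation
    [|p| = rho'] has two isolated solutions there; so at most [d / 2] gaps are
    of this kind.

    This requires [d] to be finite.  The function [|p|^2 - rho^2] is the real
    part of an exponential sum with [(m + 1)^2 + 1] terms and frequencies at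
    most [2 lambda].  On an interval so short that the operators
    [(D - a)^2 + b^2] killing its terms are disconjugate, Rolle's theorem
    bounds its zeros by twice the number of terms, unless it vanishes there. *)
Require Import Defs.
From HB Require Import structures.
From mathcomp Require Import all_boot all_order all_algebra.
From mathcomp Require Import complex finmap.
From mathcomp Require Import all_classical all_reals all_analysis.
From mathcomp Require Import zify ring lra.
Import Order.TTheory GRing.Theory Num.Theory.
Import numFieldNormedType.Exports.
Local Open Scope classical_set_scope.
Local Open Scope ring_scope.

Section zeros.
Context {R : realType}.
Implicit Types (f g df : R -> R) (J : set R) (s : seq (R[i] * R[i])).

Lemma within_continuous_derive f df (a b : R) :
  (forall t, t \in `[a, b] -> is_derive t 1 f (df t)) ->
  {within `[a, b], continuous f}.
Proof.
move=> fdf; apply: derivable_within_continuous => t tab.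
exact: (@ex_derive _ _ _ _ _ _ _ (fdf t tab)).
Qed.

Lemma rolle_sorted J f df : is_interval J ->
  (forall t, J t -> is_derive t 1 f (df t)) ->
  forall zs : seq R, sorted <%R zs ->
    (forall z, z \in zs -> J z /\ f z = 0) ->
  exists ys : seq R, [/\ sorted <%R ys, size ys = (size zs).-1 &
    forall y, y \in ys -> J y /\ df y = 0].
Proof.
move=> iJ fdf [|x zs]; first by exists [::].
move=> /= xzs Jzs.
suff: exists ys : seq R, [/\ path <%R x ys, size ys = size zs &
    forall y, y \in ys -> J y /\ df y = 0].
  by case=> ys [/path_sorted ? ? ?]; exists ys.
elim: zs x xzs Jzs => [x _ _|z zs IH x /= /andP[xz zzs] Jzs]; first by exists [::].
have Jxz t : t \in `[x, z] -> J t.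
  rewrite in_itv/= => xtz; apply: (iJ x z) => //.
  - by have [] := Jzs x (mem_head _ _).
  - by have [|] := Jzs z; rewrite ?inE ?eqxx ?orbT.
have fxz : f x = f z.
  have [|_ ->] := Jzs x; first by rewrite mem_head.
  by have [|_ ->] := Jzs z; rewrite ?inE ?eqxx ?orbT.
have [||w wxz fw] := Rolle xz _ _ fxz.
- move=> t /subset_itv_oo_cc txz.
  exact: (@ex_derive _ _ _ _ _ _ _ (fdf t (Jxz t txz))).
- by apply: (@within_continuous_derive _ df) => t /Jxz/fdf.
have Jw : J w by apply: Jxz; exact: subset_itv_oo_cc.
have dfw : df w = 0.
  by have [_ <-] := fdf w Jw; have [_ <-] := fw.
have [|ys [zys sys Jys]] := IH z zzs.
  by move=> y yzs; apply: Jzs; rewrite inE yzs orbT.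
exists (w :: ys); split => /=; last 2 first.
- by rewrite sys.
- by move=> y; rewrite inE => /predU1P[->|/Jys].
move: wxz; rewrite in_itv/= => /andP[-> wz] /=.
case: ys {sys Jys} zys => //= y ys /andP[zy ->].
by rewrite (lt_trans wz zy).
Qed.

Lemma derive0_eq0 J f df x : is_interval J ->
  (forall t, J t -> is_derive t 1 f (df t)) ->
  (forall t, J t -> df t = 0) -> J x -> f x = 0 ->
  forall t, J t -> f t = 0.
Proof.
move=> iJ fdf df0 Jx fx0 t Jt.
have H (a b : R) : J a -> J b -> a < b -> f a = f b.
  move=> Ja Jb ab.
  have Jab u : u \in `[a, b] -> J u by rewrite in_itv/=; exact: iJ.
  have [||u uab] := @MVT _ f df a b ab.
  - by move=> v /subset_itv_oo_cc/Jab/fdf.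
  - by apply: (@within_continuous_derive _ df) => v /Jab/fdf.
  rewrite df0 ?mul0r; last by apply: Jab; exact: subset_itv_oo_cc.
  by move/eqP; rewrite subr_eq0 => /eqP.
case: (ltgtP x t) => [xt|tx|<-//].
- by rewrite -(H x t).
- by rewrite (H t x).
Qed.

(* The real part of [c * cexp (z * t)]. *)
Definition osc (c z : R[i]) (t : R) : R :=
  expR (complex.Re z * t) *
  (complex.Re c * cos (complex.Im z * t) - complex.Im c * sin (complex.Im z * t)).

Lemma is_derive_osc (c z : R[i]) (t : R) : is_derive t 1 (osc c z) (osc (c * z) z t).
Proof.
case: c z => [c1 c2] [a b]; rewrite /osc /=.
have lin (k : R) : is_derive t 1 (fun u : R => k * u) k.
  by apply: is_derive_eq; rewrite /GRing.scale/= ?mulr1 ?mulr0 ?addr0.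
have dE := @is_derive1_comp _ expR (fun u => a * u) t _ _ (is_derive_expR _) (lin a).
have dC := @is_derive1_comp _ cos (fun u => b * u) t _ _ (is_derive_cos _) (lin b).
have dS := @is_derive1_comp _ sin (fun u => b * u) t _ _ (is_derive_sin _) (lin b).
rewrite /comp/= in dE dC dS.
apply: is_derive_eq.
rewrite /GRing.scale/=; ring.
Qed.

Definition osum s t : R := \sum_(p <- s) osc p.1 p.2 t.

Definition osum_deriv s := [seq (p.1 * p.2, p.2) | p <- s].

Lemma is_derive_osum s (t : R) : is_derive t 1 (osum s) (osum (osum_deriv s) t).
Proof.
rewrite /osum big_map/=.
elim: s => [|p s IH].
  under eq_fun do rewrite big_nil; rewrite big_nil; exact: is_derive_cst.
under eq_fun do rewrite big_cons; rewrite big_cons.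
apply: is_deriveD; exact: is_derive_osc.
Qed.

Local Open Scope complex_scope.

Definition osum_shift (a : R) s := [seq (p.1, p.2 - a%:C) | p <- s].

Lemma osum_shiftE (a : R) s t :
  osum (osum_shift a s) t = expR (- (a * t)) * osum s t.
Proof.
rewrite /osum big_map mulr_sumr; apply: eq_bigr => -[[c1 c2] [x y]] _.
rewrite /osc/= oppr0 addr0 mulrBl addrC expRD; ring.
Qed.

Definition osum_scale (b : R) s :=
  [seq (p.1 * (p.2 * p.2 + (b ^+ 2)%:C), p.2) | p <- s].

Lemma osum_scaleE (b : R) s t :
  osum (osum_scale b s) t =
  osum (osum_deriv (osum_deriv s)) t + b ^+ 2 * osum s t.
Proof.
rewrite /osum !big_map mulr_sumr -big_split; apply: eq_bigr => -[[c1 c2] [x y]] _.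
by rewrite /osc/=; ring.
Qed.

(* Write [u t = cos (b (t - c))], where [a + i b] is the exponent of the first
   term and [g = exp (- a t) f]. Since [u'' = - b^2 u], one has
   [(u^2 (g / u)')' = u (g'' + b^2 g)]; the right-hand side no longer involves
   the first term, and two applications of Rolle's theorem lose two zeros. *)
Lemma osum_zeros (c r : R) s (zs : seq R) :
  (forall p, p \in s -> `|complex.Im p.2| * r <= pi / 2) ->
  sorted <%R zs -> (forall z, z \in zs -> `|z - c| < r /\ osum s z = 0) ->
  ((size s).*2 < size zs)%N ->
  forall t, `|t - c| < r -> osum s t = 0.
Proof.
move En : (size s) => n.
elim: n s En zs => [|n IH] [|[c0 z0] s]//= En zs sr szs Jzs nzs.
  by move=> t _; rewrite /osum big_nil.
case: En => En.
pose J := [set t : R | `|t - c| < r].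
have iJ : is_interval J.
  rewrite (_ : J = [set` `]c - r, c + r[]); first exact: interval_is_interval.
  by apply/seteqP; split => t; rewrite /J /= in_itv/= ltr_distl.
pose a := complex.Re z0; pose b := complex.Im z0.
pose s1 := osum_shift a ((c0, z0) :: s).
pose G := osum s1; pose G1 := osum (osum_deriv s1).
pose G2 := osum (osum_deriv (osum_deriv s1)).
pose u (t : R) := cos (b * (t - c)); pose v (t : R) := sin (b * (t - c)).
have u_gt0 t : J t -> 0 < u t.
  rewrite /J/= => tr; apply: cos_gt0_pihalf; rewrite -ltr_norml normrM.
  have := sr _ (mem_head _ _); rewrite /= -/b => br.
  have [->|b0] := eqVneq b 0; first by rewrite normr0 mul0r divr_gt0// pi_gt0.
  by apply: lt_le_trans br; rewrite ltr_pM2l// normr_gt0.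
have lin (t : R) : is_derive t 1 (fun t : R => b * (t - c)) b.
  apply: is_derive_eq.
  by rewrite /GRing.scale/= subr0 ?mulr1 ?mulr0 ?addr0.
have du (t : R) : is_derive t 1 u (- (b * v t)).
  have := @is_derive1_comp _ cos _ t _ _ (is_derive_cos _) (lin t).
  by rewrite mulNr mulrC.
have dv (t : R) : is_derive t 1 v (b * u t).
  have := @is_derive1_comp _ sin _ t _ _ (is_derive_sin _) (lin t).
  by rewrite mulrC.
have dG (t : R) : is_derive t 1 G (G1 t) by exact: is_derive_osum.
have dG1 (t : R) : is_derive t 1 G1 (G2 t) by exact: is_derive_osum.
pose h (t : R) := G1 t * u t + G t * (b * v t).
have dh (t : R) : is_derive t 1 h (u t * (G2 t + b ^+ 2 * G t)).
  apply: is_derive_eq; rewrite /GRing.scale/=; ring.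
pose q (t : R) := G t * (u t)^-1.
have dq (t : R) : J t -> is_derive t 1 q (h t / u t ^+ 2).
  move=> /u_gt0 ut; have u0 : u t != 0 by rewrite gt_eqF.
  have dV := is_deriveV u0 (du t).
  apply: is_derive_eq; rewrite /GRing.scale/= /h; field.
  exact: u0.
have Gq0 t : G t = 0 -> q t = 0 by rewrite /q => ->; rewrite mul0r.
have G0 t : (G t == 0) = (osum ((c0, z0) :: s) t == 0).
  by rewrite /G osum_shiftE mulf_eq0 gt_eqF// expR_gt0.
have Jzsq z : z \in zs -> J z /\ q z = 0.
  by move=> /Jzs[Jz /eqP]; rewrite -G0 => /eqP/Gq0.
have [ys [sys ysz Jys]] := rolle_sorted _ _ _ iJ dq zs szs Jzsq.
have Jysh y : y \in ys -> J y /\ h y = 0.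
  move=> /Jys[Jy /eqP]; rewrite mulf_eq0 invr_eq0 expf_eq0/= (gt_eqF (u_gt0 _ Jy)).
  by rewrite orbF => /eqP.
have [ws [sws wsz Jws]] := rolle_sorted _ _ _ iJ (fun t _ => dh t) ys sys Jysh.
pose s2 := osum_scale b (osum_shift a s).
have s2E t : osum s2 t = G2 t + b ^+ 2 * G t.
  rewrite -osum_scaleE /s2 /s1 /osum_scale /osum_shift/= [RHS]/osum big_cons/=.
  rewrite (_ : _ * (_ + _) = 0) ?/osc/= ?mul0r ?subrr ?mulr0 ?add0r//.
  rewrite /a /b; case: (z0) => x y.
  apply/eqP; rewrite mulf_eq0; apply/orP; right.
  by rewrite eq_complex/=; apply/andP; split; apply/eqP; ring.
have s2_0 : forall t, `|t - c| < r -> osum s2 t = 0.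
  apply: (IH s2 _ ws) => //.
  - by rewrite /s2 !size_map.
  - move=> _ /mapP[_ /mapP[p ps ->] ->]/=.
    have := sr p; rewrite inE ps orbT => /(_ erefl).
    by case: (p.2) => x y /=; rewrite oppr0 addr0.
  - move=> w /Jws[Jw] /eqP; rewrite s2E mulf_eq0 (gt_eqF (u_gt0 _ Jw))/=.
    by move=> /eqP.
  - by rewrite wsz ysz; move: nzs; rewrite doubleS; case: (size zs) => [|[|k]].
have yys : nth 0 ys 0 \in ys.
  by rewrite mem_nth// ysz; move: nzs; rewrite doubleS; case: (size zs) => [|[|k]].
have zzs : nth 0 zs 0 \in zs by rewrite mem_nth//; exact: leq_ltn_trans nzs.
have h0 t : J t -> h t = 0.
  have [Jy hy] := Jysh _ yys.
  apply: (@derive0_eq0 J h _ _ iJ (fun t _ => dh t) _ Jy hy) => {}t Jt.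
  by rewrite -s2E s2_0 ?mulr0.
move=> t Jt; apply/eqP; rewrite -G0.
have [Jz qz] := Jzsq _ zzs.
have : q t = 0.
  apply: (@derive0_eq0 J q _ _ iJ dq _ Jz qz) => // {Jt}{}t Jt.
  by rewrite h0// mul0r.
by move=> /eqP; rewrite mulf_eq0 invr_eq0 (gt_eqF (u_gt0 _ Jt)) orbF.
Qed.

End zeros.

Section modulus.
Context {R : realType} {m : nat}.
Implicit Types (p : exp_poly R m) (I : set R).
Local Open Scope complex_scope.

Definition ep_modulus p (t : R) : R := complex.Re `|ep_eval p t|.

Lemma ep_modulusE p t : `|ep_eval p t| = (ep_modulus p t)%:C.
Proof. by rewrite /ep_modulus normc_def. Qed.

Lemma ep_modulus_ge0 p t : 0 <= ep_modulus p t.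
Proof. by rewrite /ep_modulus normc_def/= sqrtr_ge0. Qed.

Definition sq_modulus_terms p : seq (R[i] * R[i]) :=
  [seq (coef p i * (coef p j)^*%C, expo p i + (expo p j)^*%C)
  | i <- enum 'I_m.+1, j <- enum 'I_m.+1].

Lemma oscE (c z : R[i]) (t : R) : osc c z t = complex.Re (c * cexp (z * t%:C)).
Proof. by case: c z => [c1 c2] [a b]; rewrite /osc/= !mulr0 !add0r subr0; ring. Qed.

Lemma cexpDconj (z w : R[i]) : cexp (z + w^*%C) = cexp z * (cexp w)^*%C.
Proof.
case: z w => [a b] [c d]; rewrite /cexp/= expRD cosB sinB.
by apply/eqP; rewrite eq_complex/=; apply/andP; split; apply/eqP; ring.
Qed.

Lemma sq_modulusE p t : ep_modulus p t ^+ 2 = osum (sq_modulus_terms p) t.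
Proof.
have -> : ep_modulus p t ^+ 2 = complex.Re (ep_eval p t * (ep_eval p t)^*%C).
  by rewrite -sqr_normc ep_modulusE -rmorphXn.
rewrite /ep_eval rmorph_sum mulr_suml raddf_sum/= /osum big_allpairs_dep/= big_enum/=.
apply: eq_bigr => i _; rewrite mulr_sumr raddf_sum/= big_enum/=.
apply: eq_bigr => j _; rewrite oscE mulrDl.
have -> : (expo p j)^*%C * t%:C = (expo p j * t%:C)^*%C.
  by rewrite rmorphM/= oppr0.
rewrite cexpDconj rmorphM/=; congr complex.Re; ring.
Qed.

Lemma size_sq_modulus_terms p : size (sq_modulus_terms p) = (m.+1 ^ 2)%N.
Proof. by rewrite size_allpairs size_enum_ord. Qed.

Lemma sq_modulus_freq p q : q \in sq_modulus_terms p ->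
  `|complex.Im q.2| <= 2 * max_freq p.
Proof.
move=> /allpairsP[[i j] [_ _ ->]] /=.
have H k : `|complex.Im (expo p k)| <= max_freq p.
  exact: (le_bigmax _ (fun k => `|complex.Im (expo p k)|)).
have -> : complex.Im (expo p i + (expo p j)^*%C) =
    complex.Im (expo p i) - complex.Im (expo p j).
  by case: (expo p i) => a b; case: (expo p j).
by rewrite (le_trans (ler_normB _ _))// mulr_natl mulr2n lerD.
Qed.

Lemma ep_modulus_continuous p : continuous (ep_modulus p).
Proof.
have -> : ep_modulus p = Num.sqrt \o osum (sq_modulus_terms p).
  by apply/funext => t /=; rewrite -sq_modulusE sqrtr_sqr ger0_norm// ep_modulus_ge0.
move=> t; apply: continuous_comp; last exact: sqrt_continuous.
have [d _] := is_derive_osum (sq_modulus_terms p) t.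
exact/differentiable_continuous/derivable1_diffP.
Qed.

Lemma level_solutionsE p I (rho : R) :
  level_solutions p I rho = [set t | I t /\ ep_modulus p t = rho].
Proof.
rewrite /level_solutions; apply: eq_set => t; rewrite ep_modulusE.
by apply/propext; split=> -[It]; [move/complexI | move=> ->].
Qed.

Lemma sublevelE p I (rho : R) :
  sublevel p I rho = [set t | I t /\ ep_modulus p t <= rho].
Proof. by rewrite /sublevel; apply: eq_set => t; rewrite ep_modulusE lecR. Qed.

Definition level_terms p (rho : R) : seq (R[i] * R[i]) :=
  ((- (rho ^+ 2))%:C, 0) :: sq_modulus_terms p.

Lemma osum_levelE p (rho t : R) :
  osum (level_terms p rho) t = ep_modulus p t ^+ 2 - rho ^+ 2.
Proof.
rewrite /osum big_cons -/(osum _ _) -sq_modulusE addrC; congr +%R.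
by rewrite /osc/= !mul0r expR0 cos0; ring.
Qed.

(* More zeros than [osum_zeros] allows would make the modulus constant between
   them, so that none of the inner ones could be isolated. *)
Lemma isolated_level_short p I (rho c r : R) (zs : seq R) : is_interval I ->
  2 * max_freq p * r <= pi / 2 -> 0 <= r -> sorted <%R zs ->
  (forall z, z \in zs -> isolated (level_solutions p I rho) z /\ `|z - c| < r) ->
  (size zs <= (m.+1 ^ 2).+1.*2)%N.
Proof.
move=> iI hr r0 szs Jzs; rewrite leqNgt; apply/negP => nzs.
pose s := level_terms p rho.
have zsI z : z \in zs -> I z /\ ep_modulus p z = rho.
  by move=> /Jzs[/isolatedS + _]; rewrite level_solutionsE.
have s0 : forall t, `|t - c| < r -> osum s t = 0.
  apply: (osum_zeros c r s zs) => //.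
  - move=> q; rewrite inE => /predU1P[->|/sq_modulus_freq qf].
      by rewrite normr0 mul0r divr_ge0// pi_ge0.
    by apply: le_trans hr; rewrite ler_wpM2r.
  - by move=> z zzs; rewrite osum_levelE (zsI z zzs).2 subrr; split=> //; have [] := Jzs z zzs.
  - by rewrite /= size_sq_modulus_terms.
have size3 : (2 < size zs)%N by apply: leq_trans nzs; rewrite doubleS.
have H k : (k < 3)%N -> nth 0 zs k \in zs.
  by move=> k3; rewrite mem_nth// (leq_trans k3).
set z0 := nth 0 zs 0; set z1 := nth 0 zs 1; set z2 := nth 0 zs 2.
have lt01 : z0 < z1 by apply: (sorted_ltn_nth lt_trans) => //; rewrite inE; exact: ltn_trans size3.
have lt12 : z1 < z2 by apply: (sorted_ltn_nth lt_trans) => //; rewrite inE; exact: ltn_trans size3.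
have [[_ [V + VE]] z1c] := Jzs z1 (H 1%N isT).
move=> /nbhs_ballP[e /= e0 eV].
have [[Iz0 rz0] z0c] := (zsI _ (H 0%N isT), (Jzs _ (H 0%N isT)).2).
have [[Iz2 _] z2c] := (zsI _ (H 2%N isT), (Jzs _ (H 2%N isT)).2).
pose y := Num.min (z1 + e / 2) z2.
have z1y : z1 < y by rewrite lt_min lt12 ltrDl divr_gt0.
have yz2 : y <= z2 by rewrite ge_min lexx orbT.
have yz1 : y <= z1 + e / 2 by rewrite ge_min lexx.
suff : [set z1] y by move=> /= yE; rewrite yE ltxx in z1y.
rewrite -VE; split.
  apply: eV; rewrite /ball/= ltr0_norm ?subr_lt0// opprB ltrBlDl.
  by apply: le_lt_trans yz1 _; rewrite ltrD2l ltr_pdivrMr// ltr_pMr// ltr1n.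
rewrite level_solutionsE; split.
  by apply: (iI z0 z2) => //; rewrite (ltW (lt_trans lt01 z1y)).
have /eqP : osum s y = 0.
  apply: s0; move: z0c z2c; rewrite -/z0 -/z2 !ltr_distl => /andP[h1 _] /andP[_ h2].
  by rewrite (lt_trans h1 (lt_trans lt01 z1y))/= (le_lt_trans yz2).
rewrite osum_levelE subr_eq0 eqrXn2// ?ep_modulus_ge0// => [/eqP//|].
by rewrite -rz0 ep_modulus_ge0.
Qed.

End modulus.

Section levels.
Context {R : realType}.
Implicit Types (A I : set R).

Lemma mu1E A : mu1 A = @lebesgue_measure R A.
Proof. by []. Qed.

Lemma is_interval_lebesgue_measurable I : is_interval I -> lebesgue_measurable I.
Proof. by move=> /measurable_realfun.is_interval_measurable; exact: sub_caratheodory. Qed.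

Lemma mu1_itv_le (a b : R) (x y : bool) : a <= b ->
  mu1 [set` Interval (BSide x a) (BSide y b)] = (b - a)%:E.
Proof.
rewrite mu1E lebesgue_measure_itv/= lte_fin le_eqVlt => /predU1P[<-|->].
  by rewrite ltxx subrr.
by rewrite EFinB.
Qed.

Lemma le_mu1 A I : lebesgue_measurable A -> lebesgue_measurable I ->
  A `<=` I -> (mu1 A <= mu1 I)%E.
Proof. by move=> mA mI; apply: (le_measure (@completed_lebesgue_measure R)); rewrite inE. Qed.

Lemma interval_of_length_diam (l : R) I (x y : R) :
  interval_of_length l I -> I x -> I y -> x <= y -> y - x <= l.
Proof.
move=> [iI lI] Ix Iy xy; rewrite -lee_fin -lI -(mu1_itv_le x y true false xy).
apply: le_mu1; first exact/is_interval_lebesgue_measurable/interval_is_interval.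
  exact: is_interval_lebesgue_measurable.
by move=> z /=; rewrite in_itv/=; exact: iI.
Qed.

Lemma size_le_sum_count (T : eqType) K (P : 'I_K -> pred T) (s : seq T) :
  (forall z, z \in s -> exists k, P k z) ->
  (size s <= \sum_(k < K) count (P k) s)%N.
Proof.
elim: s => [//|z s IH] sP /=; rewrite big_split/= -add1n leq_add//.
  by have [|k kz] := sP z; rewrite ?mem_head// (bigD1 k)//= kz.
by apply: IH => y ys; apply: sP; rewrite inE ys orbT.
Qed.

Lemma isolated_level_bounded (m : nat) (lam l : R) : exists N : nat,
  forall (p : exp_poly R m) I (rho : R),
    max_freq p = lam -> interval_of_length l I ->
  forall zs, sorted <%R zs ->
    (forall z, z \in zs -> isolated (level_solutions p I rho) z) ->
  (size zs <= N)%N.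
Proof.
pose r : R := pi / 2 / (2 * `|lam| + 1).
have d_gt0 : 0 < 2 * `|lam| + 1 by rewrite ltr_wpDl// mulr_ge0.
have r_gt0 : 0 < r by rewrite divr_gt0// divr_gt0// pi_gt0.
pose K := Num.bound (l / r).
exists (K * (m.+1 ^ 2).+1.*2)%N => p I rho plam lI [//|a zs] azs zsI.
have Jzs z : z \in a :: zs -> I z by move/zsI/isolatedS => [].
pose P (k : 'I_K) (z : R) := `|z - (a + k%:R * r)| < r.
apply: (@leq_trans (\sum_(k < K) count (P k) (a :: zs))); last first.
  rewrite -[X in (_ <= X * _)%N]card_ord -sum_nat_const leq_sum// => k _.
  rewrite -size_filter.
  apply: (@isolated_level_short _ _ p I rho (a + k%:R * r) r).
  - by case: lI.
  - rewrite plam /r mulrA ler_pdivrMr// mulrC ler_wpM2l ?divr_ge0 ?pi_ge0//.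
    by rewrite (le_trans (ler_wpM2l _ (ler_norm lam)))// lerDl.
  - exact: ltW.
  - exact: (sorted_filter lt_trans).
  - by move=> z; rewrite mem_filter => /andP[Pz /zsI].
apply: size_le_sum_count => z zzs.
have az : a <= z.
  move: zzs; rewrite inE => /predU1P[->//|zzs].
  by move: azs => /= /(order_path_min lt_trans)/allP/(_ z zzs)/ltW.
have zal : z - a <= l.
  by apply: (interval_of_length_diam l I) => //; apply: Jzs; rewrite // mem_head.
have q0 : 0 <= (z - a) / r by rewrite divr_ge0 ?subr_ge0// ltW.
have /andP[k1 k2] := truncn_itv q0.
have kK : (Num.truncn ((z - a) / r) < K)%N.
  rewrite -(ltr_nat R) (le_lt_trans k1)// (le_lt_trans (_ : _ <= l / r))//.
    by rewrite ler_pM2r// invr_gt0.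
  by rewrite archi_boundP// divr_ge0 ?(ltW r_gt0)// (le_trans _ zal)// subr_ge0.
exists (Ordinal kK); rewrite /P/=.
move: k1 k2; rewrite ler_pdivlMr// ltr_pdivrMr// => k1 k2.
rewrite mulrSr mulrDl mul1r in k2.
by rewrite ltr_norml; apply/andP; split; lra.
Qed.

Lemma isolated_level_card (m : nat) (lam l : R) : exists N : nat,
  forall (p : exp_poly R m) I (rho : R),
    max_freq p = lam -> interval_of_length l I ->
  exists2 d, (d <= N)%N & (isolated (level_solutions p I rho) #= `I_d)%card.
Proof.
have [N NP] := isolated_level_bounded m lam l.
exists N => p I rho plam lI; set A := isolated _.
have fsetN (F : {fset R}) : [set` F] `<=` A -> (#|` F| <= N)%N.
  move=> FA; rewrite -(size_sort <=%R).
  apply: (NP p I rho) => //; first by rewrite sort_lt_sorted fset_uniq.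
  by move=> z; rewrite mem_sort => /FA.
have finA : finite_set A.
  apply: contrapT => /(infinite_set_fset N.+1)[F FA].
  by rewrite ltnNge fsetN.
exists #|` fset_set A|; first by apply: fsetN; rewrite fset_setK.
by rewrite -{1}(fset_setK finA); exact/card_eq_fsetP.
Qed.

Lemma max_solutionsP (m : nat) (p : exp_poly R m) (B : set R) (lam l : R) :
  max_freq p = lam -> interval_of_length l B ->
  is_max_solutions (Diagram m lam l) (max_solutions (Diagram m lam l)).
Proof.
move=> plam lB; rewrite /max_solutions.
have [N NP] := isolated_level_card m lam l.
pose Q d := `[< exists (p : exp_poly R m) I rho,
  (max_freq p = lam /\ interval_of_length l I) /\
  (isolated (level_solutions p I rho) #= `I_d)%card >].
have [d0 d0N Bd0] := NP p B 0 plam lB.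
have exQ : exists d, Q d by exists d0; apply/asboolP; exists p, B, 0.
have QN d : Q d -> (d <= N)%N.
  move=> /asboolP[p' [I [rho [[p'lam lI] Id]]]].
  have [d' d'N Id'] := NP p' I rho p'lam lI.
  suff /card_eq_II -> : (`I_d #= `I_d')%card by [].
  by apply: card_eq_trans Id'; rewrite card_eq_sym.
case: (xgetP 0%N [set d | is_max_solutions (Diagram m lam l) d]) => [d _ //|].
have [d /asboolP dQ dmax] := ex_maxnP exQ QN.
move=> /(_ d); apply: contra_notP => _; split=> //= p' I rho [p'lam lI].
have [d' d'N Id'] := NP p' I rho p'lam lI.
rewrite (card_le_eql Id') card_le_II dmax//.
by apply/asboolP; exists p', I, rho.
Qed.

End levels.

Section identity.
Context {R : realType}.
Implicit Types (s : seq (R[i] * R[i])).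

Lemma small_radius s : exists2 r : R, 0 < r &
  forall p, p \in s -> `|complex.Im p.2| * r <= pi / 2.
Proof.
elim: s => [|q s [r r0 IH]]; first by exists 1.
have d0 : 0 < `|complex.Im q.2| + 1 by rewrite ltr_wpDl.
have pi2 : (0 : R) < pi / 2 by rewrite divr_gt0// pi_gt0.
exists (Num.min r (pi / 2 / (`|complex.Im q.2| + 1))).
  by rewrite lt_min r0 divr_gt0.
move=> p; rewrite inE => /predU1P[->|ps].
  apply: (@le_trans _ _ (`|complex.Im q.2| * (pi / 2 / (`|complex.Im q.2| + 1)))).
    by rewrite ler_wpM2l// ge_min lexx orbT.
  by rewrite mulrA ler_pdivrMr// mulrC ler_wpM2l ?(ltW pi2)// lerDl.
apply: le_trans (IH p ps); by rewrite ler_wpM2l// ge_min lexx.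
Qed.

Lemma limit_point_ball (Z : set R) (c r w : R) :
  (forall t, `|t - c| < r -> Z t) -> `|w - c| < r -> limit_point Z w.
Proof.
move=> cZ wc U /nbhs_ballP[e /= e0 eU].
pose d := Num.min (e / 2) ((r - `|w - c|) / 2).
have d0 : 0 < d by rewrite lt_min !divr_gt0// subr_gt0.
have de : d <= e / 2 by rewrite ge_min lexx.
have dr : d <= (r - `|w - c|) / 2 by rewrite ge_min lexx orbT.
exists (w + d); split.
- by rewrite -subr_eq0 addrAC subrr add0r gt_eqF.
- apply: cZ; rewrite addrAC (le_lt_trans (ler_normD _ _))// (gtr0_norm d0).
  lra.
- apply: eU; rewrite /ball/= opprD addrA subrr add0r normrN gtr0_norm//; lra.
Qed.

Lemma limit_point_osum_eq0 s z :
  limit_point [set t | osum s t = 0] z -> forall t, osum s t = 0.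
Proof.
set Z := [set t | _] => zZ t.
have [r r0 sr] := small_radius s.
have step c w : `|w - c| < r -> limit_point Z w ->
    forall u, `|u - c| < r -> osum s u = 0.
  move=> wc /limit_point_infinite_setP wZ.
  have /wZ /(infinite_set_fset (size s).*2.+1)[F FZ sF] :
      nbhs w [set u | `|u - c| < r].
    apply/nbhs_ballP; exists (r - `|w - c|) => /=; first by rewrite subr_gt0.
    move=> u; rewrite /ball/= => wu.
    rewrite -(subrKA w) (le_lt_trans (ler_normD _ _))// distrC; lra.
  apply: (osum_zeros c r s (sort <=%R F)) => //.
  - by rewrite sort_lt_sorted fset_uniq.
  - by move=> u; rewrite mem_sort => /FZ[].
  - by rewrite size_sort.
pose K := Num.bound (`|t - z| / r); pose h := (t - z) / K.+1%:R.
have hr : `|h| <= r.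
  rewrite /h normrM normfV [X in _ / X]ger0_norm// ler_pdivrMr// mulrC.
  rewrite -ler_pdivrMr// (le_trans (ltW (archi_boundP _)))//.
    by rewrite divr_ge0// ltW.
  by rewrite ler_nat.
have prop k : forall u, `|u - (z + k%:R * h)| < r -> osum s u = 0.
  elim: k => [|k IH]; first by apply: (step _ z); rewrite ?mul0r ?addr0 ?subrr ?normr0.
  apply: (step _ (z + k%:R * h + h / 2)).
    rewrite [k.+1%:R]mulrSr mulrDl mul1r (_ : _ - _ = - (h / 2)); last by field.
    by rewrite normrN normrM [X in _ * X]ger0_norm//; lra.
  apply: limit_point_ball IH _.
  rewrite addrAC subrr add0r normrM [X in _ * X]ger0_norm//; lra.
by apply: (prop K.+1); rewrite /h mulrCA mulfV// mulr1 [z + _]addrC subrK subrr normr0.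
Qed.

End identity.

Section coverings.
Context {R : realType}.
Implicit Types (A I Omega : set R).

Lemma isolated_level (m : nat) (p : exp_poly R m) I (rho t z : R) :
  ep_modulus p t != rho -> I z -> ep_modulus p z = rho ->
  isolated (level_solutions p I rho) z.
Proof.
move=> trho Iz zrho.
have : closure (level_solutions p I rho) z.
  by apply: subset_closure; rewrite level_solutionsE.
rewrite closure_isolated_limit_point => -[//|zlim]; exfalso.
have /limit_point_osum_eq0/(_ t)/eqP :
    limit_point [set u | osum (level_terms p rho) u = 0] z.
  move=> U /zlim[y [yz + Uy]]; rewrite level_solutionsE => -[_ yrho].
  by exists y; split => //=; rewrite osum_levelE yrho subrr.
rewrite osum_levelE subr_eq0 eqrXn2// ?ep_modulus_ge0 ?(negPf trho)//.
by rewrite -zrho ep_modulus_ge0.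
Qed.

Lemma closure_inf A : A !=set0 -> has_lbound A -> closure A (inf A).
Proof.
move=> A0 lbA; apply: contrapT => /existsNP[U /not_implyP[/nbhs_ballP[e /= e0 eU] UA]].
have [|x Ax xe] := @inf_adherent _ A e e0; first by split.
apply: UA; exists x; split=> //; apply: eU.
have infx := ge_inf lbA Ax.
by rewrite /ball/= ler0_norm ?subr_le0// opprB ltrBlDl.
Qed.

Lemma interval_of_length_cc (a eps : R) : 0 <= eps ->
  interval_of_length eps `[a, a + eps].
Proof.
move=> e0; split; first exact: interval_is_interval.
by rewrite mu1_itv_le ?lerDl// addrAC subrr add0r.
Qed.

(* Greedy covering: the first interval starts at [inf A], and one continues
   with the part of [A] lying beyond it. *)
Lemma separated_points (eps : R) A n : 0 < eps -> has_lbound A ->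
  ~ Defs.covered_by eps A n ->
  exists t : nat -> R, (forall i, (i < n)%N -> t i + eps <= t i.+1) /\
    (forall i, (i <= n)%N -> closure A (t i)).
Proof.
move=> e0; elim: n A => [|n IH] A lbA ncov.
  exists (fun=> inf A); split => // i _; apply: closure_inf => //.
  apply: contra_notP ncov => A0; exists (fun=> set0); split; first by case.
  by move=> x Ax; exfalso; apply: A0; exists x.
set a := inf A.
have A0 : A !=set0.
  apply: contra_notP ncov => A0; exists (fun=> `[0, 0 + eps]%classic).
  split; first by move=> _; apply: interval_of_length_cc; exact: ltW.
  by move=> x Ax; exfalso; apply: A0; exists x.
have [|[J [Je AJ]]|t [tgap tA]] := IH (A `&` [set x | a + eps < x]).
- by case: lbA => b Ab; exists b => x [/Ab].
- apply: ncov; exists (fun i => if unlift ord0 i is Some j then J j else `[a, a + eps]%classic).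
  split.
    by move=> i; case: unliftP => // _; apply: interval_of_length_cc; exact: ltW.
  move=> x Ax; have [xa|ax] := leP x (a + eps).
    exists ord0 => //; rewrite unlift_none /= in_itv/= xa andbT.
    exact: ge_inf.
  have [j _ Jx] := AJ x (conj Ax ax).
  by exists (lift ord0 j) => //; rewrite liftK.
exists (fun i => if i is i'.+1 then t i' else a); split.
  case=> [_|i]; last by rewrite ltnS; exact: tgap.
  have : closure [set x | a + eps <= x] (t 0%N).
    by apply: closureS (tA 0%N isT) => x [_ /ltW].
  exact: closed_ge.
case=> [_|i]; first exact: closure_inf.
by rewrite ltnS => /tA; apply: closureS; exact: subIsetl.
Qed.

Lemma mu1_covered (eps : R) A n : lebesgue_measurable A ->
  Defs.covered_by eps A n -> (mu1 A <= (eps *+ n)%:E)%E.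
Proof.
move=> mA [J [Je AJ]].
pose J' (i : nat) := if insub i is Some j then J j else set0.
have J'E (j : 'I_n) : J' j = J j by rewrite /J' valK.
have mJ i : (i < n)%N -> lebesgue_measurable (J' i).
  move=> ni; rewrite (J'E (Ordinal ni)).
  exact/is_interval_lebesgue_measurable/(Je _).1.
have := @content_subadditive _ _ _ (@completed_lebesgue_measure R) A J' n mJ mA.
rewrite -bigcup_mkord => /(_ _)/le_trans-> //.
  by move=> x /AJ[j _ Jx]; exists (val j) => /=; rewrite ?ltn_ord// J'E.
rewrite (eq_bigr (fun=> eps%:E)); last by move=> i _; rewrite J'E; exact: (Je i).2.
by rewrite sumEFin sumr_const card_ord.
Qed.

Lemma covering_numberP (eps : R) A : 0 < eps -> bounded_set A ->
  Defs.covered_by eps A (covering_number eps A) /\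
  forall k, Defs.covered_by eps A k -> (covering_number eps A <= k)%N.
Proof.
move=> e0 [M [_ /(_ (`|M| + 1)) MA]].
have {}MA x : A x -> `|x| <= `|M| + 1.
  by apply: MA; rewrite (le_lt_trans (ler_norm _))// ltrDl.
have exn : exists n, `[< Defs.covered_by eps A n >].
  apply: contrapT => /forallNP ncov.
  pose n := Num.bound ((`|M| + 1) *+ 2 / eps).
  have [||t [tgap tA]] := @separated_points eps A n e0.
  - by exists (- (`|M| + 1)) => x /MA; rewrite ler_norml => /andP[].
  - by move=> An; apply: (ncov n); apply/asboolP.
  have tle i : (i <= n)%N -> t 0%N + eps *+ i <= t i.
    elim: i => [_|i IH ni]; first by rewrite addr0.
    by rewrite mulrSr addrA (le_trans _ (tgap i ni))// lerD2r IH// ltnW.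
  have tM i : (i <= n)%N -> `|t i| <= `|M| + 1.
    move=> /tA ti.
    have : closure ([set x | x <= `|M| + 1] `&` [set x | - (`|M| + 1) <= x]) (t i).
      by apply: closureS ti => x /MA; rewrite ler_norml => /andP[].
    move=> /closureI[/closed_le + /closed_ge]/=.
    by rewrite ler_norml => -> ->.
  have := tM 0%N isT; have := tM n (leqnn n); have := tle n (leqnn n).
  rewrite !ler_norml => h1 /andP[_ h2] /andP[h3 _].
  have : eps *+ n <= (`|M| + 1) *+ 2 by rewrite mulr2n; lra.
  rewrite -mulr_natr -ler_pdivlMl// mulrC leNgt archi_boundP//.
  by rewrite divr_ge0 ?(ltW e0)// mulrn_wge0// addr_ge0.
have [n /asboolP An nmin] := ex_minnP exn.
apply: (@xgetPex _ 0%N [set n | Defs.covered_by eps A n /\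
  forall k, Defs.covered_by eps A k -> (n <= k)%N]).
by exists n; split => // k Ak; apply: nmin; apply/asboolP.
Qed.

Lemma mu1_le_metric_span (D : diagram R) A : bounded_set A ->
  lebesgue_measurable A -> (mu1 A <= metric_span D A)%E.
Proof.
move=> bA mA; apply/lee_addgt0Pr => e e0.
pose F : R := (freq_bound D)%:R.
have F0 : 0 < F by rewrite ltr0n.
have eF : 0 < e / F by rewrite divr_gt0.
have [cov _] := covering_numberP (e / F) A eF bA.
apply: le_trans (mu1_covered _ _ _ mA cov) _.
rewrite -leeBlDr// -EFinB; apply: ereal_sup_ubound; exists (e / F) => //=.
by congr EFin; rewrite -/F mulrBr divfK ?gt_eqF// mulr_natr.
Qed.

End coverings.

Section sublevels.
Context {R : realType}.
Implicit Types (A B : set R).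

Lemma size_le_card (T : choiceType) (A : set T) (s : seq T) d :
  uniq s -> (forall x, x \in s -> A x) -> (A #<= `I_d)%card -> (size s <= d)%N.
Proof.
move=> us sA Ad; pose F := seq_fset tt s.
rewrite -(undup_id us) -(size_seq_fset tt) -card_le_II.
have FE : ([set` F] #= `I_#|` F|)%card by exact/card_eq_fsetP.
rewrite -(card_le_eql FE); apply: card_le_trans Ad; apply: subset_card_le => x /=.
by rewrite seq_fsetE; exact: sA.
Qed.

Lemma lebesgue_measurable_sublevel (m : nat) (p : exp_poly R m) B (rho : R) :
  is_interval B -> lebesgue_measurable (sublevel p B rho).
Proof.
move=> iB; rewrite sublevelE.
apply: sub_caratheodory; apply: measurableI.
  exact: measurable_realfun.is_interval_measurable.
apply: measurable_realfun.closed_measurable.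
apply: (@closed_comp _ _ (ep_modulus p) [set x | x <= rho]); last exact: closed_le.
by move=> x _; exact: ep_modulus_continuous.
Qed.

Lemma closure_interval_between A (x y z : R) : is_interval A ->
  closure A x -> closure A y -> x < z < y -> A z.
Proof.
move=> iA clx cly /andP[xz zy].
have [a [Aa /= az]] : A `&` [set u | u < z] !=set0.
  by apply: clx; exact: lt_nbhsl.
have [b [Ab /= zb]] : A `&` [set u | z < u] !=set0.
  by apply: cly; exact: lt_nbhsr.
by apply: (iA a b) => //; rewrite !ltW.
Qed.

Lemma IVT_strict (f : R -> R) (a b v : R) : a < b -> continuous f ->
  Num.min (f a) (f b) < v < Num.max (f a) (f b) ->
  exists2 c, a < c < b & f c = v.
Proof.
move=> ab cf /andP[v1 v2].
have [||c cab fc] := @IVT R f a b v (ltW ab).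
- exact: continuous_subspaceT.
- by rewrite !ltW.
exists c => //; move: cab; rewrite in_itv/= !le_eqVlt.
case/andP=> /predU1P[ac|->] /predU1P[cb|->] //; exfalso; move: v1 v2; rewrite -fc.
- by move: ab; rewrite ac cb ltxx.
- by rewrite -ac gt_min lt_max !ltxx/= => h1 h2; have := lt_trans h1 h2; rewrite ltxx.
- by rewrite cb gt_min lt_max !ltxx !orbF => h1 h2; have := lt_trans h1 h2; rewrite ltxx.
Qed.

Section gaps.
Variables (m : nat) (p : exp_poly R m) (B : set R) (rho eps : R).
Hypotheses (iB : is_interval B) (eps0 : 0 < eps).
Variables (n : nat) (t : nat -> R).
Hypothesis tgap : forall i, (i < n)%N -> t i + eps <= t i.+1.
Local Notation V := (sublevel p B rho).
Hypothesis tV : forall i, (i <= n)%N -> closure V (t i).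

Definition bad_gap (i : 'I_n) : bool :=
  `[< exists s, t i < s < t i.+1 /\ ~ V s >].

Let tlt i j : (i < j)%N -> (j <= n)%N -> t i + eps <= t j.
Proof.
elim: j => // j IH; rewrite ltnS leq_eqVlt => /predU1P[->|ij] jn; first exact: tgap.
by rewrite (le_trans (IH ij (ltnW jn)))// (le_trans _ (tgap _ jn))// lerDl ltW.
Qed.

Let tle i j : (i <= j)%N -> (j <= n)%N -> t i <= t j.
Proof.
rewrite leq_eqVlt => /predU1P[->//|ij jn].
by rewrite (le_trans _ (tlt _ _ ij jn))// lerDl ltW.
Qed.

Let tB (i : 'I_n) z : t i < z < t i.+1 -> B z.
Proof.
apply: closure_interval_between => //.
- by apply: closureS (tV i (ltnW (ltn_ord i))) => x [].
- by apply: closureS (tV i.+1 (ltn_ord i)) => x [].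
Qed.

Let trho i : (i <= n)%N -> ep_modulus p (t i) <= rho.
Proof.
move=> /tV ti.
have cl : closed (ep_modulus p @^-1` [set x | x <= rho]).
  apply: closed_comp; last exact: closed_le.
  by move=> x _; exact: ep_modulus_continuous.
by apply: cl; apply: closureS ti => x; rewrite sublevelE => -[].
Qed.

Lemma good_gaps_measure :
  ((eps *+ (n - #|[pred i | bad_gap i]|)%N)%:E <= mu1 V)%E.
Proof.
pose J (i : 'I_n) : set R := `]t i, t i + eps[%classic.
have mJ i : lebesgue_measurable (J i).
  exact/is_interval_lebesgue_measurable/interval_is_interval.
have -> : (n - #|[pred i | bad_gap i]|)%N = #|[predC [pred i | bad_gap i]]|.
  by rewrite -[X in (X - _)%N](card_ord n) -(cardC [pred i | bad_gap i]) addKn.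
have muJ i : mu1 (J i) = eps%:E.
  by rewrite mu1_itv_le ?lerDl ?(ltW eps0)// addrAC subrr add0r.
have -> : (eps *+ #|[predC [pred i | bad_gap i]]|)%:E =
    (\sum_(i < n | ~~ bad_gap i) mu1 (J i))%E.
  by rewrite (eq_bigr (fun=> eps%:E))// sumEFin sumr_const.
rewrite /mu1 -(@measure_bigsetU_ord_cond _ _ _ (@completed_lebesgue_measure R))//; last first.
  apply/trivIsetP => i j _ _ ij; rewrite -subset0 => x [].
  rewrite /J/= !in_itv/= => /andP[ix xi] /andP[jx xj].
  move: ij; rewrite -val_eqE /= neq_ltn => /orP[] ij.
  - by have := tlt _ _ ij (ltnW (ltn_ord j)); rewrite leNgt (lt_trans jx xi).
  - by have := tlt _ _ ij (ltnW (ltn_ord i)); rewrite leNgt (lt_trans ix xj).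
  by move=> i _; exact: mJ.
apply: (le_measure (@completed_lebesgue_measure R)); rewrite ?inE.
- by apply: bigsetU_measurable => i _; exact: mJ.
- exact: lebesgue_measurable_sublevel.
apply: (big_ind (fun X : set R => X `<=` V)) => [//|X Y XV YV x [/XV|/YV]//|i].
move=> igood x.
rewrite /J/= in_itv/= => /andP[ix xi]; apply: contrapT => Vx.
move: igood; rewrite /bad_gap => /asboolPn; apply; exists x; split => //.
by rewrite ix (lt_le_trans xi)// tgap.
Qed.

(* Raising the level slightly above [rho] makes the modulus cross it twice in
   every gap of length [>= eps] that is not contained in [V]; the crossings are
   then strict, whereas at level [rho] the two ends of a gap may be shared with
   its neighbours. *)
Lemma bad_gaps_solutions (d : nat) :
  (forall r : R, (isolated (level_solutions p B r) #<= `I_d)%card) ->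
  (#|[pred i | bad_gap i]|.*2 <= d)%N.
Proof.
move=> dB.
have /choice[s sP] (i : 'I_n) : exists s, bad_gap i ->
    t i < s < t i.+1 /\ rho < ep_modulus p s.
  have [/asboolP[s [tst Vs]]|] := boolP (bad_gap i); last by exists 0.
  exists s => _; split=> //; rewrite ltNge; apply/negP => srho.
  by apply: Vs; rewrite sublevelE; split => //; exact: (tB i).
pose mu := \big[Num.min/rho + 1]_(i < n | bad_gap i) ep_modulus p (s i).
have rhomu : rho < mu.
  rewrite /mu; apply: (big_ind (fun x => rho < x)); first by rewrite ltrDl.
    by move=> x y rx ry; rewrite lt_min rx.
  by move=> i /sP[].
have mule i : bad_gap i -> mu <= ep_modulus p (s i).
  by move=> bi; exact: bigmin_le_cond.
pose rho' := (rho + mu) / 2.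
have rr' : rho < rho' by rewrite /rho'; lra.
have r'mu : rho' < mu by rewrite /rho'; lra.
have /choice[z zP] (ib : 'I_n * bool) : exists z, bad_gap ib.1 ->
    ((if ib.2 then s ib.1 else t ib.1) < z <
     (if ib.2 then t ib.1.+1 else s ib.1)) /\ ep_modulus p z = rho'.
  case: ib => i b /=; have [bi|] := boolP (bad_gap i); last by exists 0.
  have [/andP[tis sit] rhos] := sP i bi.
  have ti := trho i (ltnW (ltn_ord i)); have ti1 := trho i.+1 (ltn_ord i).
  have mi := mule i bi.
  case: b.
  - have [|z zi zr] := @IVT_strict (ep_modulus p) (s i) (t i.+1) rho' sit
        (@ep_modulus_continuous _ _ p).
      by rewrite gt_min lt_max (le_lt_trans ti1 rr') orbT (lt_le_trans r'mu mi).
    by exists z.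
  - have [|z zi zr] := @IVT_strict (ep_modulus p) (t i) (s i) rho' tis
        (@ep_modulus_continuous _ _ p).
      by rewrite gt_min lt_max (le_lt_trans ti rr') (lt_le_trans r'mu mi) orbT.
    by exists z.
have ztt i b : bad_gap i -> t i < z (i, b) < t i.+1.
  move=> bi; have [/andP[h1 h2] _] := zP (i, b) bi.
  have [/andP[h3 h4] _] := sP i bi.
  by case: b h1 h2 => /= h1 h2; rewrite ?h1 ?h2 ?(lt_trans h3 h1) ?(lt_trans h2 h4).
have zlt i j b c : bad_gap i -> bad_gap j -> (i < j)%N -> z (i, b) < z (j, c).
  move=> bi bj ij; have /andP[_ h1] := ztt i b bi; have /andP[h2 _] := ztt j c bj.
  by rewrite (lt_trans h1)// (le_lt_trans _ h2)// tle// ltnW.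
have -> : (#|[pred i | bad_gap i]|.*2 =
    size [seq z ib | ib <- enum [pred ib : 'I_n * bool | bad_gap ib.1]])%N.
  rewrite size_map -cardE -muln2 -card_bool -cardX; apply: eq_card => -[i b].
  by rewrite !inE andbT.
apply: (@size_le_card _ (isolated (level_solutions p B rho'))) => //.
  rewrite map_inj_in_uniq ?enum_uniq// => -[i b] [j c].
  rewrite !mem_enum => bi0 bj0 zz.
  have bi : bad_gap i := bi0; have bj : bad_gap j := bj0.
  move=> {bi0 bj0}.
  have ij : i = j.
    case: (ltngtP i j) => [ij|ij|/ord_inj//]; exfalso.
    - by have := zlt _ _ b c bi bj ij; rewrite zz ltxx.
    - by have := zlt _ _ c b bj bi ij; rewrite zz ltxx.
  rewrite -{}ij in bj zz *; congr pair.
  have [/andP[b1 b2] _] := zP (i, b) bi; have [/andP[c1 c2] _] := zP (i, c) bi.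
  case: b c zz b1 b2 c1 c2 => -[]//= -> h1 h2 h3 h4.
  - by have := lt_trans h1 h4; rewrite ltxx.
  - by have := lt_trans h3 h2; rewrite ltxx.
move=> _ /mapP[[i b] + ->]; rewrite mem_enum => bi0; have bi : bad_gap i := bi0.
apply: (@isolated_level _ _ _ _ _ (t i)).
- by rewrite lt_eqF// (le_lt_trans (trho i (ltnW (ltn_ord i)))).
- exact/(tB i)/ztt.
- exact: (zP (i, b) bi).2.
Qed.

End gaps.

Lemma bounded_setS (A B : set R) : A `<=` B -> bounded_set B -> bounded_set A.
Proof.
by move=> AB [M [Mr MB]]; exists M; split=> // x xM a /AB; exact: MB.
Qed.

Lemma bounded_interval_length B : is_interval B -> bounded_set B ->
  interval_of_length (fine (mu1 B)) B.
Proof.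
move=> iB [M [_ /(_ (`|M| + 1)) MB]]; split => //.
rewrite fineK// ge0_fin_numE ?measure_ge0//.
have M0 : - (`|M| + 1) <= `|M| + 1 by rewrite ge0_cp// addr_ge0.
apply: (@le_lt_trans _ _ (mu1 `[- (`|M| + 1), `|M| + 1])).
  apply: le_mu1; first exact: is_interval_lebesgue_measurable.
    exact/is_interval_lebesgue_measurable/interval_is_interval.
  move=> x Bx /=; rewrite in_itv/= -ler_norml; apply: MB => //.
  by rewrite (le_lt_trans (ler_norm _))// ltrDl.
by rewrite mu1_itv_le// ltry.
Qed.

Lemma metric_span_sublevel_le (m : nat) (p : exp_poly R m) B (rho : R) :
  is_interval B -> bounded_set B ->
  (metric_span (diagram_of p B) (sublevel p B rho) <= mu1 (sublevel p B rho))%E.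
Proof.
move=> iB bB; set V := sublevel p B rho.
have bV : bounded_set V by apply: bounded_setS bB => x [].
apply: ge_ereal_sup => _ [eps /= eps0 <-].
have [_] := covering_numberP eps V eps0 bV.
case: covering_number => [_|n nmin].
  apply: le_trans (measure_ge0 _ _); rewrite lee_fin sub0r mulrN oppr_le0.
  by rewrite mulr_ge0// ltW.
have [|| t [tgap tV]] := @separated_points _ eps V n eps0.
- have [M [_ /(_ (`|M| + 1)) MV]] := bV.
  exists (- (`|M| + 1)) => x Vx.
  have : `|x| <= `|M| + 1 by apply: MV => //; rewrite (le_lt_trans (ler_norm _))// ltrDl.
  by rewrite ler_norml => /andP[].
- by move=> /nmin; rewrite ltnn.
have [_ dmax] := max_solutionsP m p B _ _ erefl (bounded_interval_length B iB bB).
have := bad_gaps_solutions m p B rho eps iB eps0 n t tgap tV _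
  (fun r => dmax p B r (conj erefl (bounded_interval_length B iB bB))).
move=> bad_le.
apply: (le_trans _ (good_gaps_measure m p B rho eps iB eps0 n t tgap)).
rewrite lee_fin -[eps *+ _]mulr_natr ler_wpM2l ?(ltW eps0)//.
rewrite lerBlDr -natrD ler_nat /freq_bound.
move: bad_le; rewrite /diagram_of.
have := max_card [pred i : 'I_n | bad_gap m p B rho n t i]; rewrite card_ord.
set d := max_solutions _; lia.
Qed.

End sublevels.

Theorem proposition2p7 (R : realType) (m : nat) (p : exp_poly R m) (B : set R) :
  is_interval B -> bounded_set B ->
  (forall Omega : set R, bounded_set Omega -> lebesgue_measurable Omega ->
     (mu1 Omega <= metric_span (diagram_of p B) Omega)%E) /\
  (forall rho : R,
     metric_span (diagram_of p B) (sublevel p B rho) = mu1 (sublevel p B rho)).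
Proof.
move=> iB bB; split; first by move=> A; exact: mu1_le_metric_span.
move=> rho.
apply/eqP; rewrite eq_le metric_span_sublevel_le//=.
apply: mu1_le_metric_span; last exact: lebesgue_measurable_sublevel.
by apply: bounded_setS bB => x [].
Qed.
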